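(* There exists a function $K^{T^\omega}:\mathbb N\to\mathbb R$ such that for any field $\mathbb K$ and any $n$ the symplectic Tits building $T^{\omega,\mathbb K}_n$ is uniformly $(n-2)$-acyclic and satisfies the $q$-UBC for all $q\le n-2$ with constant $K^{T^\omega}(n)$. In particular, $\widetilde H^q_{\mathrm{b,s}}(T^{\omega,\mathbb K}_n;\mathbb R)=0$ if $q\neq n-1$.
   Context: $T^{\omega,\mathbb K}_n$ is the poset of nontrivial isotropic subspaces $0\ne V\subseteq\mathbb K^{2n}$ with respect to the standard symplectic form $\omega$ on $\mathbb K^{2n}$, ordered by inclusion. A poset is regarded as a semi-simplicial set via its order complex: $p$-simplices are chains $x_0\lneq\dots\lneq x_p$, the $k$-th face omits $x_k$. For a semi-simplicial set $X_\bullet$: $C_q(X_\bullet)=\mathbb R[X_q]$ with $\partial_q=\sum_{i=0}^q(-1)^id_i$ and the $\ell^1$-norm; the reduced complex adds $\mathbb R$ in degree $-1$ with $\partial_0(\text{vertex})=1$; $\widetilde H^q_{\mathrm{b,s}}(X_\bullet;\mathbb R)$ is the cohomology of the complex of bounded linear functionals on the reduced complex. A normed chain complex $C_*$ satisfies the $q$-uniform boundary condition ($q$-UBC) with constant $K$ if for every $\sigma\in\partial_{q+1}(C_{q+1})$ there is $\rho\in C_{q+1}$ with $\partial\rho=\sigma$ and $\|\rho\|\le K\|\sigma\|$. A non-empty semi-simplicial set $X_\bullet$ is uniformly $n$-acyclic ($n\ge-1$) if its reduced real simplicial homology vanishes in degrees $0\le q\le n$ and the (unreduced) complex $C_*(X_\bullet)$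 satisfies the $q$-UBC for all $q\le n$. (So uniformly $(-1)$-acyclic means non-empty; for $n\le-2$ the condition is empty.) *)

(* Defs.v *)
From HB Require Import structures.
From mathcomp Require Import freeg.
From mathcomp Require Import all_boot all_order all_algebra zify.
From mathcomp Require Import boolp reals.

Set Implicit Arguments.
Unset Strict Implicit.
Unset Printing Implicit Defensive.

Import Order.TTheory GRing.Theory Num.Theory.
Local Open Scope ring_scope.

(* The simplicial identity d_i d_(j+1) = d_j d_i for i <= j: [widen_ord] and
   [lift ord0] realise i and j+1 as face indices of a (q+2)-simplex. *)
Record semiSimplicialSet := SemiSimplicialSet {
  simplex :> nat -> choiceType;
  face : forall q, 'I_q.+2 -> simplex q.+1 -> simplex q;
  faceK : forall q (i j : 'I_q.+2) (x : simplex q.+2), (i <= j)%N ->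
    face i (face (lift ord0 j) x) = face j (face (widen_ord (leqnSn _) i) x)
}.

Section OrderComplex.
Context (d : Order.disp_t) (T : porderType d).

Definition chain (p : nat) := {t : p.+1.-tuple T | sorted <%O t}.

HB.instance Definition _ p := Choice.on (chain p).

Lemma face_chain_proof p (k : 'I_p.+2) (x : chain p.+1) :
  sorted <%O [tuple tnth (sval x) (lift k i) | i < p.+1].
Proof.
case: x => t /= st.
have ltT : transitive (<%O : rel T) by exact: lt_trans.
have x0 := tnth t ord0.
apply/(sortedP x0) => i; rewrite size_tuple ?card_ord => ltiSp.
have ltip : (i < p.+1)%N by exact: ltnW.
have ntE m : (m < p.+1)%N ->
    nth x0 [tuple tnth t (lift k i) | i < p.+1] m = nth x0 t (bump k m).
  move=> ltm; rewrite -(tnth_nth x0 [tuple tnth t (lift k i) | i < p.+1]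
    (Ordinal ltm)).
  by rewrite tnth_mktuple (tnth_nth x0).
rewrite !ntE //.
apply: (sorted_ltn_nth ltT x0 st); rewrite ?inE ?size_tuple //=.
all: by rewrite /bump; lia.
Qed.

Definition face_chain p (k : 'I_p.+2) (x : chain p.+1) : chain p :=
  exist (fun t : p.+1.-tuple T => sorted <%O t) _ (face_chain_proof k x).

Lemma face_chainK q (i j : 'I_q.+2) (x : chain q.+2) : (i <= j)%N ->
  face_chain i (face_chain (lift ord0 j) x) =
  face_chain j (face_chain (widen_ord (leqnSn _) i) x).
Proof.
move=> leij; apply/val_inj/eq_from_tnth => k /=.
rewrite !tnth_mktuple; congr tnth; apply: val_inj; rewrite /= /bump.
by do ![case: leqP => /= ?]; lia.
Qed.

Definition order_complex : semiSimplicialSet :=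
  @SemiSimplicialSet chain face_chain face_chainK.

End OrderComplex.

(* Chain complexes are indexed by [nat]; a complex starting in degree -1 is
   represented with its degrees shifted by one. *)
Record normedComplex (R : realType) := NormedComplex {
  cobj :> nat -> lmodType R;
  bd : forall q, {linear cobj q.+1 -> cobj q};
  cnorm : forall q, cobj q -> R;
  bdK : forall q (c : cobj q.+2), bd q (bd q.+1 c) = 0;
  cnorm_ge0 : forall q (c : cobj q), 0 <= cnorm c;
  cnorm_eq0 : forall q (c : cobj q), cnorm c = 0 -> c = 0;
  cnormD : forall q (a b : cobj q), cnorm (a + b) <= cnorm a + cnorm b;
  cnormZ : forall q (r : R) (c : cobj q), cnorm (r *: c) = `|r| * cnorm c;
  bd_bounded : forall q, exists M : R,
    forall c : cobj q.+1, cnorm (bd q c) <= M * cnorm c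
}.

Section NormedComplexTheory.
Context (R : realType) (C : normedComplex R).

Definition is_cycle q : C q -> Prop :=
  if q is p.+1 then fun c => bd C p c = 0 else fun _ => True.

Definition is_boundary q (c : C q) : Prop := exists b : C q.+1, bd C q b = c.

Definition homology_vanishes q : Prop :=
  forall c : C q, is_cycle c -> is_boundary c.

Definition UBC q (K : R) : Prop :=
  forall s : C q, is_boundary s ->
    exists r : C q.+1, bd C q r = s /\ cnorm r <= K * cnorm s.

Definition bounded_functional q (f : {scalar C q}) : Prop :=
  exists M : R, forall c : C q, `|f c| <= M * cnorm c.

Definition is_cocycle q (f : {scalar C q}) : Prop :=
  forall c : C q.+1, f (bd C q c) = 0.

Definition is_bounded_coboundary q : {scalar C q} -> Prop :=
  match q with
  | 0%N => fun f => forall c, f c = 0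
  | p.+1 => fun f => exists2 g : {scalar C p},
      bounded_functional g & forall c, f c = g (bd C p c)
  end.

Definition bounded_cohomology_vanishes q : Prop :=
  forall f : {scalar C q}, bounded_functional f -> is_cocycle f ->
    is_bounded_coboundary f.

End NormedComplexTheory.

Section FreeModule.
Context (R : realType) (T : choiceType).

Definition l1norm (c : {freeg T / R}) : R := \sum_(x <- dom c) `|coeff x c|.

Lemma l1normE (s : seq T) (c : {freeg T / R}) :
  uniq s -> {subset dom c <= s} -> l1norm c = \sum_(x <- s) `|coeff x c|.
Proof.
move=> us sub; rewrite /l1norm [RHS](bigID (mem (dom c))) /=.
rewrite [X in _ + X]big1 ?addr0; last first.
  by move=> x /coeff_outdom->; rewrite normr0.
rewrite -[RHS]big_filter; apply: perm_big; apply: uniq_perm.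
- exact: uniq_dom.
- exact: filter_uniq.
- move=> x; rewrite mem_filter /=; apply/idP/andP => [xc|[]//].
  by split=> //; apply: sub.
Qed.

Lemma l1norm_ge0 (c : {freeg T / R}) : 0 <= l1norm c.
Proof. by apply: sumr_ge0 => x _; exact: normr_ge0. Qed.

Lemma l1norm_eq0 (c : {freeg T / R}) : l1norm c = 0 -> c = 0.
Proof.
move=> /eqP; rewrite psumr_eq0 => [|x _]; last exact: normr_ge0.
move=> /allP c0; apply/eqP; rewrite -dom_eq0 -size_eq0 size_eq0.
case E: (dom c) => [//|x s].
have xc : x \in dom c by rewrite E mem_head.
by have := c0 x xc; rewrite normr_eq0 => /eqP cx; move: xc; rewrite mem_dom cx eqxx.
Qed.

Lemma l1normD (a b : {freeg T / R}) : l1norm (a + b) <= l1norm a + l1norm b.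
Proof.
pose s := undup (dom a ++ dom b).
have us : uniq s by exact: undup_uniq.
rewrite !(l1normE us) => [|x|x|x].
- rewrite -big_split /=; apply: ler_sum => x _.
  by rewrite coeffD; exact: ler_normD.
- by move=> xb; rewrite mem_undup mem_cat xb orbT.
- by move=> xa; rewrite mem_undup mem_cat xa.
- by move=> /domD_subset; rewrite mem_undup.
Qed.

Lemma l1normZ (r : R) (c : {freeg T / R}) : l1norm (r *: c) = `|r| * l1norm c.
Proof.
rewrite (l1normE (uniq_dom c)); last exact: domZ_subset.
by rewrite mulr_sumr; apply: eq_bigr => x _; rewrite coeffZ normrM.
Qed.

Lemma fglift_is_linear (M : lmodType R) (f : T -> M) :
  linear (fglift f : {freeg T / R} -> M).
Proof.
have addf := lift_is_additive f.
have f0 : fglift f 0 = 0 by rewrite -(subrr 0) addf subrr.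
have fN a : fglift f (- a) = - fglift f a by rewrite -[- a]add0r addf f0 add0r.
have fD a b : fglift f (a + b) = fglift f a + fglift f b.
  by rewrite -{1}[b]opprK addf fN opprK.
have fS (I : Type) (r : seq I) (F : I -> {freeg T / R}) :
    fglift f (\sum_(i <- r) F i) = \sum_(i <- r) fglift f (F i).
  by elim: r => [|i r IH]; rewrite ?big_nil ?big_cons ?f0 // fD IH.
move=> r a b; rewrite fD; congr (_ + _).
rewrite -{2}[a]freeg_sumE fS scaler_sumr.
rewrite [r *: a]/GRing.scale /= /fgscale fS.
by apply: eq_bigr => x _; rewrite !liftU scalerA.
Qed.

HB.instance Definition _ (M : lmodType R) (f : T -> M) :=
  GRing.isLinear.Build R {freeg T / R} M *:%R (fglift f) (fglift_is_linear f).

Lemma fgliftE (M : lmodType R) (f : T -> M) (c : {freeg T / R}) :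
  fglift f c = \sum_(x <- dom c) coeff x c *: f x.
Proof.
rewrite -{1}[c]freeg_sumE linear_sum.
by apply: eq_bigr => x _; rewrite /= liftU.
Qed.

End FreeModule.

Section SimplicialChains.
Context (R : realType) (X : semiSimplicialSet).

Definition simplicial_bd q : {linear {freeg (X q.+1) / R} -> {freeg (X q) / R}} :=
  fglift (fun x => \sum_(i < q.+2) (-1) ^+ i *: << face i x >>).

Definition augmentation : {linear {freeg (X 0%N) / R} -> R^o} :=
  fglift (fun=> 1 : R^o).

Lemma simplicial_bdK q (c : {freeg (X q.+2) / R}) :
  simplicial_bd q (simplicial_bd q.+1 c) = 0.
Proof.
rewrite -[c]freeg_sumE !linear_sum big1 // => x _.
have -> : << coeff x c *g x >> = coeff x c *: (<< x >> : {freeg (X q.+2) / R}).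
  by apply/eqP/freeg_eqP => y; rewrite coeffZ !coeffU mul1r.
rewrite !linearZ /= liftU scale1r linear_sum /=.
rewrite [X in _ *: X](_ : _ = 0) ?scaler0 //.
rewrite (eq_bigr (fun j : 'I_q.+3 => \sum_(i < q.+2)
  (-1) ^+ (j + i) *: (<< face i (face j x) >> : {freeg (X q) / R}))); last first.
  move=> j _; rewrite linearZ /= liftU scale1r scaler_sumr.
  by apply: eq_bigr => i _; rewrite scalerA exprD.
under eq_bigr => j _ do rewrite (bigID (fun i : 'I_q.+2 => (i < j)%N)) /=.
rewrite big_split /= big_ord_recl [X in X + _ + _]big_pred0 // add0r.
rewrite [X in _ + X]big_ord_recr /= [X in _ + (_ + X)]big_pred0 ?addr0; last first.
  by move=> i; rewrite ltn_ord.
rewrite [X in _ + X](exchange_big_dep xpredT) //= -big_split big1 // => j _ /=.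
rewrite (eq_bigl (fun i : 'I_q.+2 => ~~ (j < i)%N)); last first.
  by move=> i; rewrite /bump; lia.
rewrite -big_split big1 // => i lij /=.
rewrite faceK; last by rewrite leqNgt.
by rewrite -scalerDl /bump /= add1n addSn exprS mulN1r addnC addNr scale0r.
Qed.

Lemma fglift_l1_bounded (T : choiceType) (S : choiceType)
    (f : S -> {freeg T / R}) (M : R) :
  (forall x, l1norm (f x) <= M) ->
  forall c : {freeg S / R}, l1norm (fglift f c) <= M * l1norm c.
Proof.
move=> fM c; rewrite fgliftE /l1norm mulr_sumr.
have le_sum (s : seq S) (F : S -> {freeg T / R}) :
    l1norm (\sum_(x <- s) F x) <= \sum_(x <- s) l1norm (F x).
  elim: s => [|x s IH]; last first.
    by rewrite !big_cons (le_trans (l1normD _ _)) // lerD2l.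
  by rewrite !big_nil /l1norm dom0 big_nil.
apply: le_trans (le_sum _ _) _; apply: ler_sum => x _.
by rewrite l1normZ mulrC ler_wpM2r.
Qed.

Lemma simplicial_bd_bounded q : exists M : R,
  forall c, l1norm (simplicial_bd q c) <= M * l1norm c.
Proof.
exists q.+2%:R; apply: fglift_l1_bounded => x.
have sum_le n (F : 'I_n -> {freeg (X q) / R}) :
    (forall i, l1norm (F i) <= 1) -> l1norm (\sum_(i < n) F i) <= n%:R.
  elim: n F => [|n IH] F F1; first by rewrite big_ord0 /l1norm dom0 big_nil.
  rewrite big_ord_recr /= (le_trans (l1normD _ _)) // -natr1.
  by apply: lerD => //; apply: IH.
apply: sum_le => i; rewrite l1normZ normrX normrN1 expr1n mul1r.
by rewrite /l1norm domU1 big_seq1 coeffU eqxx mulr1 normr1.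
Qed.

Lemma augmentation_bounded : exists M : R,
  forall c, `|augmentation c| <= M * l1norm c.
Proof.
exists 1 => c; rewrite mul1r /augmentation /= fgliftE /l1norm.
apply: le_trans (ler_norm_sum _ _ _) _; apply: ler_sum => x _.
by rewrite normrM normr1 mulr1.
Qed.

Lemma augmentationK (c : {freeg (X 1) / R}) :
  augmentation (simplicial_bd 0 c) = 0.
Proof.
rewrite -[c]freeg_sumE !linear_sum big1 // => x _.
have -> : << coeff x c *g x >> = coeff x c *: (<< x >> : {freeg (X 1) / R}).
  by apply/eqP/freeg_eqP => y; rewrite coeffZ !coeffU mul1r.
rewrite !linearZ /= liftU scale1r linear_sum /=.
rewrite !big_ord_recl big_ord0 addr0 !linearZ /= !liftU.
by rewrite expr0 expr1 !scale1r scaleN1r subrr scaler0.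
Qed.

Definition chains : normedComplex R :=
  @NormedComplex R (fun q => {freeg (X q) / R} : lmodType R)
    simplicial_bd (fun=> @l1norm R _) simplicial_bdK
    (fun=> @l1norm_ge0 R _) (fun=> @l1norm_eq0 R _)
    (fun=> @l1normD R _) (fun=> @l1normZ R _) simplicial_bd_bounded.

Definition reduced_obj (k : nat) : lmodType R :=
  if k is q.+1 then {freeg (X q) / R} else R^o.

Definition reduced_bd k : {linear reduced_obj k.+1 -> reduced_obj k} :=
  if k is q.+1 then simplicial_bd q else augmentation.

Definition reduced_norm k : reduced_obj k -> R :=
  if k is q.+1 then @l1norm R (X q) else fun r => `|r|.

Lemma reduced_bdK k (c : reduced_obj k.+2) :
  reduced_bd k (reduced_bd k.+1 c) = 0.
Proof. by case: k c => [|k] c; [exact: augmentationK | exact: simplicial_bdK]. Qed.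

Lemma reduced_norm_ge0 k (c : reduced_obj k) : 0 <= reduced_norm c.
Proof. by case: k c => [|k] c; [exact: normr_ge0 | exact: l1norm_ge0]. Qed.

Lemma reduced_norm_eq0 k (c : reduced_obj k) : reduced_norm c = 0 -> c = 0.
Proof. by case: k c => [|k] c; [exact: normr0_eq0 | exact: l1norm_eq0]. Qed.

Lemma reduced_normD k (a b : reduced_obj k) :
  reduced_norm (a + b) <= reduced_norm a + reduced_norm b.
Proof. by case: k a b => [|k] a b; [exact: ler_normD | exact: l1normD]. Qed.

Lemma reduced_normZ k (r : R) (c : reduced_obj k) :
  reduced_norm (r *: c) = `|r| * reduced_norm c.
Proof. by case: k c => [|k] c; [exact: normrM | exact: l1normZ]. Qed.

Lemma reduced_bd_bounded k : exists M : R,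
  forall c, reduced_norm (reduced_bd k c) <= M * reduced_norm c.
Proof.
by case: k => [|k]; [exact: augmentation_bounded | exact: simplicial_bd_bounded].
Qed.

(* Index [k] carries degree [k - 1]. *)
Definition reduced_chains : normedComplex R :=
  NormedComplex reduced_bdK reduced_norm_ge0 reduced_norm_eq0 reduced_normD
    reduced_normZ reduced_bd_bounded.

Definition reduced_homology_vanishes (q : int) : Prop :=
  forall k : nat, k%:Z - 1 = q -> homology_vanishes reduced_chains k.

(* In degrees [q < -1] the reduced complex is zero, and the condition is
   vacuous. *)
Definition reduced_bounded_cohomology_vanishes (q : int) : Prop :=
  forall k : nat, k%:Z - 1 = q -> bounded_cohomology_vanishes reduced_chains k.

(* Degrees [q < 0] need no UBC, since the unreduced complex has no nonzero
   boundaries there. *)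
Definition uniformly_acyclic (n : int) : Prop :=
  -1 <= n ->
  [/\ inhabited (X 0),
      forall q : nat, q%:Z <= n -> reduced_homology_vanishes q &
      forall q : nat, q%:Z <= n -> exists K : R, UBC chains q K].

End SimplicialChains.

Section SymplecticTitsBuilding.
Context (F : fieldType) (n : nat).

Definition omega (u v : 'rV[F]_(n + n)) : F :=
  \sum_(i < n) (u 0 (lshift n i) * v 0 (rshift n i) -
                u 0 (rshift n i) * v 0 (lshift n i)).

Definition isotropic (V : {vspace 'rV[F]_(n + n)}) : Prop :=
  forall u v, u \in V -> v \in V -> omega u v = 0.

Definition isotropic_subspace :=
  {V : {vspace 'rV[F]_(n + n)} | (V != 0%VS) && `[< isotropic V >]}.

HB.instance Definition _ := Choice.on isotropic_subspace.

Definition le_isotropic (V W : isotropic_subspace) := (val V <= val W)%VS.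

Lemma le_isotropic_refl : reflexive le_isotropic.
Proof. by move=> V; exact: subvv. Qed.

Lemma le_isotropic_anti : antisymmetric le_isotropic.
Proof. by move=> V W VW; apply: val_inj; apply: subv_anti. Qed.

Lemma le_isotropic_trans : transitive le_isotropic.
Proof. by move=> W V U; exact: subv_trans. Qed.

HB.instance Definition _ := Order.Le_isPOrder.Build (Order.Disp tt tt)
  isotropic_subspace le_isotropic_refl le_isotropic_anti le_isotropic_trans.

Definition symplectic_Tits_building : semiSimplicialSet :=
  order_complex isotropic_subspace.

End SymplecticTitsBuilding.

(* Main.v *)
Require Import Defs.
From HB Require Import structures.
From mathcomp Require Import freeg.
From mathcomp Require Import all_boot all_order all_algebra zify ring.
From mathcomp Require Import boolp reals.
Import Order.TTheory GRing.Theory Num.Theory.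
Local Open Scope ring_scope.

Set Implicit Arguments.
Unset Strict Implicit.
Unset Printing Implicit Defensive.

(** All three conclusions follow from one construction: a linear homotopy [h]
with [bd h + h bd = id] on the reduced chains of the building in degrees
[<= n - 2], whose norm is bounded by a number depending on [n] only.  Such an
[h] fills every cycle at a controlled cost, which is acyclicity together with
the uniform boundary condition, and composing a bounded cocycle with [h]
exhibits it as a bounded coboundary.  In degrees [>= n] there are no simplices,
because an isotropic subspace has dimension at most [n].

The homotopy comes from an induction over links.  For an isotropic [U] let
[above U] be the poset of isotropic subspaces strictly containing [U]; the
building is [above 0].  If [\dim U + k <= n], then [above U] has a homotopy on
chains with at most [k - 1] vertices ([contractible_above]).  For [k > 0] a
dimension count yields a vector [e] orthogonal to [U] and not in [U]
([exists_polar_notin]).  Let [polar e] be the subspace orthogonal to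
[e], and call [V] bad when [V :&: polar e] is just [U].
- On the subspaces that are not bad, the monotone maps
  [V >= V :&: polar e <= (V :&: polar e) + <[e]> >= U + <[e]>] contract the poset,
  and prism operators turn this into a homotopy whose norm is linear in the
  number of vertices ([conical_contraction]).
- A bad [V] has dimension [\dim U + 1], hence is a minimal element, and the
  elements above it form [above V].  The whole poset is therefore obtained from
  the contractible part by attaching cones over the posets [above V], which
  have homotopies by induction ([attach_cones]).
Links are again of the form [above V] inside the same symplectic space, so no
identification of the orthogonal of [V] modulo [V] with a standard symplectic
space is involved, and the constants do not see the field.

Chains are handled as linear combinations of lists of vertices, where the empty
list is the simplex of degree [-1]: a list of length [m] is a simplex of degree
[m - 1], and the boundary satisfies [bd (x :: s) = s - x :: bd s].  This single
recursion replaces the alternating sums, and [to_list], [of_list] translate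
back and forth. *)

(** * Supports and norms in free modules *)

Section FreeModules.
Context (R : realType) (T : choiceType).
Implicit Types (S : T -> bool) (c : {freeg T / R}).

Lemma fgliftU1 (M : lmodType R) (f : T -> M) x :
  fglift f (<< x >> : {freeg T / R}) = f x.
Proof. by rewrite liftU scale1r. Qed.

Lemma freegU_scale k (x : T) : << k *g x >> = k *: (<< x >> : {freeg T / R}).
Proof. by apply/eqP/freeg_eqP => y; rewrite coeffZ !coeffU mul1r. Qed.

Lemma l1normU (x : T) : l1norm (<< x >> : {freeg T / R}) = 1.
Proof. by rewrite /l1norm domU1 big_seq1 coeffU eqxx mulr1 normr1. Qed.

Lemma l1norm0 : l1norm (0 : {freeg T / R}) = 0.
Proof. by rewrite /l1norm dom0 big_nil. Qed.

Lemma l1normN c : l1norm (- c) = l1norm c.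
Proof. by rewrite -scaleN1r l1normZ normrN1 mul1r. Qed.

Definition supported S c := forall x, x \in dom c -> S x.

Lemma supported0 S : supported S 0.
Proof. by move=> x; rewrite dom0. Qed.

Lemma supportedU S x : S x -> supported S << x >>.
Proof. by move=> Sx y; rewrite domU1 inE => /eqP->. Qed.

Lemma supportedD S a b : supported S a -> supported S b -> supported S (a + b).
Proof.
move=> Sa Sb x /domD_subset; rewrite mem_cat => /orP[]; [exact: Sa|exact: Sb].
Qed.

Lemma supportedZ S k c : supported S c -> supported S (k *: c).
Proof. by move=> Sc x /domZ_subset; exact: Sc. Qed.

Lemma supportedN S c : supported S c -> supported S (- c).
Proof. by rewrite -scaleN1r; exact: supportedZ. Qed.

Lemma supportedB S a b : supported S a -> supported S b -> supported S (a - b).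
Proof. by move=> Sa Sb; apply: supportedD => //; exact: supportedN. Qed.

Lemma supported_sub S S' c : (forall x, S x -> S' x) ->
  supported S c -> supported S' c.
Proof. by move=> SS' Sc x /Sc /SS'. Qed.

Lemma eq_on_support S (M : lmodType R)
    (f g : {linear {freeg T / R} -> M}) c :
  (forall x, S x -> f << x >> = g << x >>) -> supported S c -> f c = g c.
Proof.
move=> fg Sc; rewrite -[c]freeg_sumE !linear_sum !big_seq.
by apply: eq_bigr => x /Sc Sx; rewrite freegU_scale !linearZ /= fg.
Qed.

Lemma eq_on_basis (M : lmodType R) (f g : {linear {freeg T / R} -> M}) c :
  (forall x, f << x >> = g << x >>) -> f c = g c.
Proof. by move=> fg; apply: (@eq_on_support xpredT). Qed.

End FreeModules.

Section LiftBounds.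
Context (R : realType) (T T' : choiceType).

Lemma supported_lift (S : T -> bool) (S' : T' -> bool)
    (f : T -> {freeg T' / R}) (c : {freeg T / R}) :
  (forall x, S x -> supported S' (f x)) -> supported S c ->
  supported S' (fglift f c).
Proof.
move=> Sf Sc; rewrite fgliftE big_seq.
elim/big_ind: _ => [|a b|x /Sc /Sf fx]; first exact: supported0.
- exact: supportedD.
- exact: supportedZ.
Qed.

Lemma l1norm_lift (S : T -> bool) (f : T -> {freeg T' / R}) (K : R)
    (c : {freeg T / R}) :
  0 <= K -> (forall x, S x -> l1norm (f x) <= K) -> supported S c ->
  l1norm (fglift f c) <= K * l1norm c.
Proof.
move=> K0 fK Sc; pose f' x := if S x then f x else 0.
rewrite (_ : fglift f c = fglift f' c).
  apply: fglift_l1_bounded => x; rewrite /f'; case: ifP => [/fK //|_].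
  by rewrite l1norm0.
apply: (@eq_on_support _ _ S _ (fglift f) (fglift f')) => // x Sx /=.
by rewrite !fgliftU1 /f' Sx.
Qed.

End LiftBounds.

(** * Chains on lists of vertices *)

Section ListChains.
Context (R : realType) (T : choiceType).
Local Notation C := {freeg (seq T) / R}.

Definition cone (x : T) : C -> C := fglift (fun s => << x :: s >>).
HB.instance Definition _ x :=
  GRing.Linear.copy (cone x) (fglift (fun s => << x :: s >> : C)).

Fixpoint list_bd (s : seq T) : C :=
  if s is x :: s' then << s' >> - cone x (list_bd s') else 0.

Definition bdl : C -> C := fglift list_bd.
HB.instance Definition _ := GRing.Linear.copy bdl (fglift list_bd).

Lemma coneU x s : cone x << s >> = << x :: s >>.
Proof. exact: fgliftU1. Qed.

Lemma bdlU s : bdl << s >> = list_bd s.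
Proof. exact: fgliftU1. Qed.

Lemma bdl_cons x s : bdl << x :: s >> = << s >> - cone x (bdl << s >>).
Proof. by rewrite !bdlU. Qed.

(** The recursion defining the boundary, extended linearly: coning off a chain
is a homotopy, which is the source of every computation below. *)
Lemma bdl_cone x c : bdl (cone x c) = c - cone x (bdl c).
Proof.
apply: (@eq_on_basis _ _ _ (bdl \o cone x) (idfun \- (cone x \o bdl))) => s /=.
by rewrite coneU bdl_cons.
Qed.

Lemma l1norm_cone x c : l1norm (cone x c) <= l1norm c.
Proof.
rewrite -[leRHS]mul1r; apply: (@l1norm_lift _ _ _ xpredT) => // s _.
by rewrite l1normU.
Qed.

Lemma supported_cone (S S' : seq T -> bool) x c :
  (forall s, S s -> S' (x :: s)) -> supported S c -> supported S' (cone x c).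
Proof. by move=> SS'; apply: supported_lift => s /SS' ?; exact: supportedU. Qed.

Lemma supported_bdl s :
  supported (fun t => subseq t s && (size s == (size t).+1)) (bdl << s >>).
Proof.
elim: s => [|x s IH]; first by rewrite bdlU; exact: supported0.
rewrite bdl_cons; apply: supportedB.
  by apply: supportedU; rewrite subseq_cons /=.
apply: supported_cone IH => t /andP[ts /eqP sz].
by rewrite /= eqxx ts sz eqxx.
Qed.

Context (f g : T -> T).

Definition mapl (h : T -> T) : C -> C := fglift (fun s => << map h s >>).
HB.instance Definition _ h :=
  GRing.Linear.copy (mapl h) (fglift (fun s => << map h s >> : C)).

Lemma maplU h s : mapl h << s >> = << map h s >>.
Proof. exact: fgliftU1. Qed.

Lemma mapl_cone h x c : mapl h (cone x c) = cone (h x) (mapl h c).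
Proof.
apply: (@eq_on_basis _ _ _ (mapl h \o cone x) (cone (h x) \o mapl h)) => s /=.
by rewrite coneU !maplU coneU.
Qed.

Lemma bdl_mapl h c : bdl (mapl h c) = mapl h (bdl c).
Proof.
apply: (@eq_on_basis _ _ _ (bdl \o mapl h) (mapl h \o bdl)) => /=.
elim=> [|x s IH]; first by rewrite maplU /= !bdlU /= linear0.
by rewrite maplU /= !bdl_cons linearB /= mapl_cone -IH !maplU.
Qed.

(** The chain [\sum_i (-1)^i [f x_0, .., f x_i, g x_i, .., g x_p]] of the
prism between the images of a simplex under [f] and [g]. *)
Fixpoint list_prism (s : seq T) : C :=
  if s is x :: s' then << f x :: map g s >> - cone (f x) (list_prism s') else 0.

Definition prism : C -> C := fglift list_prism.
HB.instance Definition _ := GRing.Linear.copy prism (fglift list_prism).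

Lemma prism_cons x s :
  prism << x :: s >> = << f x :: map g (x :: s) >> - cone (f x) (prism << s >>).
Proof. by rewrite /prism !fgliftU1. Qed.

Lemma prism_cone x c : prism (cone x c) =
  cone (f x) (mapl g (cone x c)) - cone (f x) (prism c).
Proof.
apply: (@eq_on_basis _ _ _ (prism \o cone x)
  ((cone (f x) \o mapl g \o cone x) \- (cone (f x) \o prism))) => s /=.
by rewrite coneU prism_cons maplU coneU.
Qed.

(** The chain homotopy formula of the prism holds for all lists and all maps;
order matters only for the prism to consist of chains of the poset. *)
Lemma bdl_prism c : bdl (prism c) + prism (bdl c) = mapl g c - mapl f c.
Proof.
apply: (@eq_on_basis _ _ _ ((bdl \o prism) \+ (prism \o bdl))
  (mapl g \- mapl f)) => /=.
elim=> [|x s IH].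
  by rewrite !maplU subrr bdlU linear0 addr0 /prism fgliftU1 linear0.
have -> : mapl f << x :: s >> = cone (f x) (mapl f << s >>).
  by rewrite !maplU coneU.
rewrite prism_cons bdl_cons -coneU -(maplU g (x :: s)) -[in mapl g _]coneU.
rewrite !linearB /= !bdl_cone.
rewrite prism_cone bdl_mapl bdl_cone !linearB /= coneU.
have -> : mapl f << s >> =
    mapl g << s >> - bdl (prism << s >>) - prism (bdl << s >>).
  by rewrite -addrA -opprD IH opprB addrCA subrr addr0.
rewrite !linearB /=.
by apply/eqP/freeg_eqP => t; rewrite !(coeffD, coeffN); ring.
Qed.

Lemma l1norm_list_prism s : l1norm (list_prism s) <= (size s)%:R.
Proof.
elim: s => [|x s IH] /=; first by rewrite l1norm0.
rewrite (le_trans (l1normD _ _)) // l1normN l1normU -natr1 addrC lerD2r.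
exact: le_trans (l1norm_cone _ _) IH.
Qed.

End ListChains.

Arguments cone {R T} x c.
Arguments bdl {R T} c.
Arguments mapl {R T} h c.
Arguments prism {R T} f g c.

(** * Chains of a poset *)

Section OrderedLists.
Context (R : realType) (d : Order.disp_t) (P : porderType d).
Local Notation C := {freeg (seq P) / R}.
Implicit Types (A B : pred P) (s t : seq P) (c : C) (f g : P -> P).

Definition strict_chain A m s := [&& sorted <%O s, all A s & size s == m].
Definition weak_chain A m s := [&& sorted <=%O s, all A s & size s == m].

(** Deleting the least vertex of a chain leaves a chain of its upper link. *)
Lemma strict_cons A m x s : strict_chain A m.+1 (x :: s) =
  A x && strict_chain (fun y => A y && (x < y)%O) m s.
Proof.
rewrite /strict_chain /= path_sortedE; last exact: lt_trans.
rewrite eqSS all_predI /=.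
by case: (A x); case: (all A s); case: (all _ s); case: (sorted _ s).
Qed.

Lemma supported_strict_bdl A m s : strict_chain A m.+1 s ->
  supported (strict_chain A m) (bdl (<< s >> : C)).
Proof.
case/and3P => ss As /eqP szs; apply: supported_sub (@supported_bdl R _ s) => t.
case/andP => ts; rewrite szs eqSS eq_sym => szt.
rewrite /strict_chain szt andbT.
rewrite (subseq_sorted lt_trans ts ss) /=.
by apply/allP => x /(mem_subseq ts); exact: (allP As).
Qed.

(** Monotone maps need not be injective, so prisms produce weakly increasing
lists.  Sending the lists with a repetition to zero is the passage from the full
to the normalized chain complex; [normalize_bdl] is its compatibility with
boundaries. *)
Definition normalize : C -> C :=
  fglift (fun s => if sorted <%O s then << s >> else 0).
HB.instance Definition _ := GRing.Linear.copy normalize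
  (fglift (fun s => if sorted <%O s then << s >> else 0 : C)).

Lemma normalizeU s :
  normalize << s >> = if sorted <%O s then << s >> else 0.
Proof. exact: fgliftU1. Qed.

Lemma normalize_strict A m c :
  supported (strict_chain A m) c -> normalize c = c.
Proof.
apply: (@eq_on_support _ _ _ _ normalize idfun) => s /and3P[ss _ _] /=.
by rewrite normalizeU ss.
Qed.

Lemma supported_normalize A m c : supported (weak_chain A m) c ->
  supported (strict_chain A m) (normalize c).
Proof.
apply: supported_lift => s /and3P[_ As szs]; case: ifP => ss.
  by apply: supportedU; rewrite /strict_chain ss As.
exact: supported0.
Qed.

Lemma l1norm_normalize c : l1norm (normalize c) <= l1norm c.
Proof.
rewrite -[leRHS]mul1r; apply: (@l1norm_lift _ _ _ xpredT) => // s _.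
by case: ifP; rewrite ?l1normU ?l1norm0.
Qed.

(** A repetition in [s] persists in [x :: s], so it can be killed before or
after coning. *)
Lemma normalize_cone x c :
  normalize (cone x c) = normalize (cone x (normalize c)).
Proof.
apply: (@eq_on_basis _ _ _ (normalize \o cone x)
  (normalize \o cone x \o normalize)).
move=> s /=; rewrite (normalizeU s); case: ifP => // nss.
rewrite !linear0 coneU normalizeU ifN //.
by apply/negP => /= /path_sorted; rewrite nss.
Qed.

(** For a strict list all faces are strict.  For a list with a repetition the
boundary normalizes to zero: if the repetition is at the head, the first two
faces cancel and the other faces still begin with it; otherwise the tail has
one, and the recursion for the boundary applies. *)
Lemma normalize_bdl_weak s : sorted <=%O s ->
  normalize (bdl << s >>) = bdl (normalize << s >>).
Proof.
move=> ws; rewrite normalizeU; case: ifP => [ss|/negbT].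
  apply: (@normalize_strict predT (size s).-1).
  case: s ws ss => [|x s] ws ss; first by rewrite bdlU; exact: supported0.
  by apply: supported_strict_bdl; rewrite /strict_chain ss all_predT /=.
rewrite linear0; elim: s ws => [//|x s IH] /= ws nss.
have wss := path_sorted ws.
rewrite bdl_cons linearB /= normalize_cone.
have [ss|nss'] := boolP (sorted <%O s).
  case: s ws nss ss {IH wss} => [//|y s] /= /andP[xy ws] nss ss.
  have exy : x = y.
    by apply/eqP; move: nss; rewrite ss andbT lt_neqAle xy andbT negbK.
  rewrite -{y}exy in ss xy ws nss *.
  rewrite -normalize_cone bdl_cons [cone x _]linearB /= coneU.
  rewrite [normalize (_ - _)]linearB /=.
  rewrite opprB addrCA subrr addr0.
  rewrite (_ : normalize _ = 0) //.
  by apply: (@eq_on_basis _ _ _ (normalize \o cone x \o cone x) \0) => t /=;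
    rewrite !coneU normalizeU /= ltxx.
by rewrite normalizeU (negbTE nss') (IH wss nss') !linear0 addr0.
Qed.

Lemma normalize_bdl A m c : supported (weak_chain A m) c ->
  normalize (bdl c) = bdl (normalize c).
Proof.
move=> wc.
apply: (@eq_on_support _ _ _ _ (normalize \o bdl) (bdl \o normalize) _ _ wc).
move=> s /=; by case/and3P => ws _ _; exact: normalize_bdl_weak.
Qed.

(** A homotopy on the chains of [A] with fewer than [k] vertices, that is, in
reduced degrees [<= k - 2].  The values on single simplices determine the linear
extension, and bounding them bounds its operator norm. *)
Definition contraction_on A (k K : nat) (h : seq P -> C) :=
  forall m s, (m < k)%N -> strict_chain A m s ->
    [/\ supported (strict_chain A m.+1) (h s), l1norm (h s) <= K%:R &
        bdl (h s) + fglift h (bdl << s >>) = << s >>].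

Definition contractible A k K := exists h, contraction_on A k K h.

Lemma contraction_lift A k K h m c : contraction_on A k K h -> (m < k)%N ->
  supported (strict_chain A m) c ->
  bdl (fglift h c) + fglift h (bdl c) = c.
Proof.
move=> hP mk sc.
apply: (@eq_on_support _ _ _ _ ((bdl \o fglift h) \+ (fglift h \o bdl)) idfun
  _ _ sc).
by move=> s /(hP _ _ mk) [_ _ /=]; rewrite fgliftU1.
Qed.

(** The zigzag [x >= f x <= g x >= v] of monotone maps contracts [A] to the point
[v].  The homotopy adds the prisms of the two comparisons of maps to the cone
from [v] over the image of [g]; the boundary terms of [f] and [g] cancel, and only
the identity survives.  A simplex with [m] vertices has a prism of [m]
simplices, whence the linear bound. *)
Section Conical.
Variables (A : pred P) (f g : P -> P) (v : P).
Hypotheses (Av : A v) (Af : forall x, A x -> A (f x))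
  (Ag : forall x, A x -> A (g x))
  (fle : forall x, A x -> (f x <= x)%O) (fg : forall x, A x -> (f x <= g x)%O)
  (vg : forall x, A x -> (v <= g x)%O)
  (fmono : forall x y, A x -> A y -> (x <= y -> f x <= f y)%O)
  (gmono : forall x y, A x -> A y -> (x <= y -> g x <= g y)%O).

Lemma weak_cons m x s : weak_chain A m.+1 (x :: s) =
  [&& A x, all (fun y => x <= y)%O s & weak_chain A m s].
Proof.
rewrite /weak_chain /= path_sortedE; last exact: le_trans.
rewrite eqSS.
by case: (A x); case: (all A s); case: (all _ s); case: (sorted _ s).
Qed.

Lemma weak_map (h : P -> P) m s : (forall x, A x -> A (h x)) ->
  (forall x y, A x -> A y -> (x <= y -> h x <= h y)%O) ->
  weak_chain A m s -> weak_chain A m (map h s).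
Proof.
move=> Ah hmono; elim: s m => [|x s IH] [|m] //.
  by case/and3P => _ _.
rewrite weak_cons => /and3P[Ax xs ws].
rewrite /= weak_cons Ah // IH // andbT /=.
apply/allP => _ /mapP[y ys ->]; apply: hmono => //; last exact: (allP xs).
by case/and3P: ws => _ /allP As _; exact: As.
Qed.

(** The second conjunct, that the prism only has vertices among the images of
[s], lets the induction compare a new least vertex with the rest. *)
Lemma supported_prism (h : P -> P) m s : (forall x, A x -> A (h x)) ->
  (forall x y, A x -> A y -> (x <= y -> h x <= h y)%O) ->
  (forall x, A x -> (f x <= h x)%O) ->
  weak_chain A m s ->
  supported (fun t => weak_chain A m.+1 t && all (mem (map f s ++ map h s)) t)
    (list_prism R f h s).
Proof.
move=> Ah hmono fh; elim: s m => [|x s IH] m.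
  by move=> _; exact: supported0.
case: m => [|m]; first by case/and3P => _ _.
move=> wxs; move: (wxs); rewrite weak_cons => /and3P[Ax xs ws] /=.
have As y : y \in s -> A y by case/and3P: ws => _ /allP Aall _; exact: Aall.
have fx y : y \in s -> (f x <= f y)%O
  by move=> ys; apply: fmono => //; [exact: As|exact: (allP xs)].
have fx' y : y \in s -> (f x <= h y)%O.
  by move=> ys; apply: le_trans (fx y ys) (fh _ _); exact: As.
apply: supportedB.
  apply: supportedU; rewrite weak_cons Af //= fh //=.
  rewrite (weak_map Ah hmono wxs) andbT -/(map h (x :: s)).
  apply/andP; split.
    by apply/allP => _ /mapP[y ys ->]; exact: fx'.
  rewrite /= !inE !mem_cat !inE !eqxx !orbT /=.
  by apply/allP => y ys /=; rewrite !inE mem_cat inE ys !orbT.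
apply: supported_cone (IH _ ws) => t /andP[wt /allP ts].
rewrite weak_cons Af // wt andbT /= inE eqxx /=.
apply/andP; split; apply/allP => y /ts /=; rewrite !mem_cat.
  by case/orP => /mapP[z zs ->]; [exact: fx|exact: fx'].
by rewrite !inE mem_cat inE => /orP[] ->; rewrite !orbT.
Qed.

Lemma conical_contraction k : contractible A k k.*2.+1.
Proof.
pose D s : C := list_prism R f id s - list_prism R f g s + << v :: map g s >>.
have DE c : fglift D c = prism f id c - prism f g c + cone v (mapl g c).
  apply: (@eq_on_basis _ _ _ (fglift D)
    ((prism f id \- prism f g) \+ (cone v \o mapl g))) => s /=.
  by rewrite fgliftU1 /D maplU coneU /prism !fgliftU1.
have DK c : bdl (fglift D c) + fglift D (bdl c) = c.
  have := bdl_prism f id c; have := bdl_prism f g c; rewrite !DE.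
  have -> : mapl id c = c.
    by apply: (@eq_on_basis _ _ _ (mapl id) idfun) => s /=; rewrite maplU map_id.
  move=> /eqP; rewrite addrC eq_sym -subr_eq => /eqP Eg.
  move=> /eqP; rewrite addrC eq_sym -subr_eq => /eqP Ef.
  rewrite !linearD !linearN /= bdl_cone bdl_mapl -Eg -Ef.
  by apply/eqP/freeg_eqP => t; rewrite !(coeffD, coeffN); ring.
have wD m s : strict_chain A m s -> supported (weak_chain A m.+1) (D s).
  case/and3P => ss As szs.
  have ws : weak_chain A m s.
    by rewrite /weak_chain As szs (sub_sorted _ ss) // => x y /ltW.
  apply: supportedD; [apply: supportedB|apply: supportedU].
  - by apply: supported_sub (@supported_prism id m s _ _ _ ws) => // t /andP[].
  - by apply: supported_sub (@supported_prism g m s _ _ _ ws) => // t /andP[].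
  - rewrite weak_cons Av weak_map // andbT /=.
    by apply/allP => _ /mapP[x xs ->]; apply: vg; exact: (allP As).
exists (fun s => normalize (D s)) => m s mk As; split.
- exact: supported_normalize (wD _ _ As).
- rewrite (le_trans (l1norm_normalize _)) // /D.
  apply: le_trans (l1normD _ _) _; rewrite l1normU -natr1 lerD2r.
  apply: le_trans (l1normD _ _) _; rewrite l1normN -addnn natrD.
  have szk : (size s <= k)%N by case/and3P: As => _ _ /eqP->; exact: ltnW.
  by rewrite lerD // (le_trans (l1norm_list_prism _ _ _ _)) // ler_nat.
- rewrite -(normalize_bdl (wD _ _ As)).
  have -> c : fglift (fun s => normalize (D s)) c = normalize (fglift D c).
    apply: (@eq_on_basis _ _ _ (fglift _) (normalize \o fglift D)) => t /=.
    by rewrite !fgliftU1.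
  rewrite -(fgliftU1 D s) -linearD /= DK normalizeU.
  by case/and3P: As => ->.
Qed.

End Conical.

Lemma strict_sub A A' m s : (forall x, A x -> A' x) ->
  strict_chain A m s -> strict_chain A' m s.
Proof.
by move=> AA' /and3P[ss As szs]; rewrite /strict_chain ss szs (sub_all AA').
Qed.

(** [A] is the part [X] outside [B] with a cone attached over the upper link of
each [b] in [B]; minimality makes [b] the first vertex of each chain through it,
and puts the link inside [X].  If [h0] contracts [X] and [hb] the link of [b],
then [- b :: hb s] pushes the simplex [b :: s] into [X], where it becomes [hb s]
and is finished off by [h0].  In degree terms the link is needed one degree lower,
as [s] has one vertex fewer than [b :: s]. *)
Lemma attach_cones A B k K L :
  (forall x y, A x -> A y -> B y -> ~~ (x < y)%O) ->
  contractible (fun x => A x && ~~ B x) k.+1 L ->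
  (forall b, A b -> B b -> contractible (fun y => A y && (b < y)%O) k K) ->
  contractible A k.+1 (L + L.+1 * K).
Proof.
move=> minB [h0 h0P] hB.
(* For [b] outside [A] or [B] the choice is arbitrary. *)
have /choice[hb hbP] : forall b, exists h, A b -> B b ->
    contraction_on (fun y => A y && (b < y)%O) k K h.
  move=> b; have [Ab|nAb] := boolP (A b); last by exists (fun=> 0).
  have [Bb|nBb] := boolP (B b); last by exists (fun=> 0).
  by have [h hP] := hB b Ab Bb; exists h.
pose X x := A x && ~~ B x.
have linkX b y : A b -> A y && (b < y)%O -> X y.
  by move=> Ab /andP[Ay by_]; rewrite /X Ay; apply: contraL by_; exact: minB.
pose h s := if s is x :: s' then
  if B x then fglift h0 (hb x s') - cone x (hb x s') else h0 s else h0 s.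
have hX m c : supported (strict_chain X m) c -> fglift h c = fglift h0 c.
  move=> sc; apply: (@eq_on_support _ _ _ _ (fglift h) (fglift h0) _ _ sc).
  move=> [|x s] /=; rewrite !fgliftU1 //=.
  by case/and3P => _ /= /andP[/andP[_ /negbTE ->]].
have hcone b c m : A b -> B b ->
    supported (strict_chain (fun y => A y && (b < y)%O) m) c ->
    fglift h (cone b c) = fglift h0 (fglift (hb b) c) - cone b (fglift (hb b) c).
  move=> Ab Bb sc.
  apply: (@eq_on_support _ _ _ _ (fglift h \o cone b)
    ((fglift h0 \o fglift (hb b)) \- (cone b \o fglift (hb b))) _ _ sc).
  by move=> s _ /=; rewrite coneU !fgliftU1 /h Bb.
have XA x : X x -> A x by case/andP.
(* A simplex of [X] stays in [X] under boundaries, where [h] is [h0]. *)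
have Xcase m s : strict_chain A m s -> strict_chain X m s -> (m < k.+1)%N ->
  [/\ supported (strict_chain A m.+1) (h0 s),
      l1norm (h0 s) <= (L + L.+1 * K)%:R &
        bdl (h0 s) + fglift h (bdl << s >>) = << s >>].
  move=> As Xs mk; have [sh nh eh] := h0P _ _ mk Xs; split.
  - by apply: supported_sub sh => t; exact: strict_sub.
  - by rewrite (le_trans nh) // ler_nat leq_addr.
  - case: m Xs {As mk sh} => [|m] Xs.
      by case/and3P: Xs eh => _ _; case: (s) => //= _; rewrite !bdlU !linear0.
    by rewrite (hX m) // ; exact: supported_strict_bdl.
exists h => m s mk As.
case: s As => [|x s] As; first by apply: Xcase.
rewrite /=; case: ifPn => [Bx|nBx]; last first.
  apply: Xcase => //.
  case: m mk As => [|m] _; first by case/and3P.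
  rewrite !strict_cons => /andP[Ax xs]; rewrite {1}/X Ax nBx /=.
  apply: strict_sub xs => y /andP[Ay xy].
  by rewrite (linkX x) ?Ay.
case: m mk As => [|m] mk; first by case/and3P.
rewrite strict_cons => /andP[Ax xs]; set c := hb x s.
have [sh nh eh] := hbP x Ax Bx _ _ mk xs; rewrite -/c in sh nh eh.
have Xc : supported (strict_chain X m.+1) c.
  by apply: supported_sub sh => t; apply: strict_sub => y; exact: linkX.
split.
- apply: supportedB.
    apply: supported_sub (supported_lift (S' := strict_chain X m.+2) _ Xc) => t.
      exact: strict_sub.
    by case/(h0P _ _ mk).
  by apply: supported_cone sh => t; rewrite strict_cons Ax.
- apply: le_trans (l1normD _ _) _; rewrite l1normN.
  have n0 : l1norm (fglift h0 c) <= L%:R * l1norm c.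
    by apply: l1norm_lift Xc => // t /(h0P _ _ mk) [].
  apply: le_trans (lerD n0 (l1norm_cone x c)) _.
  rewrite -[X in _ + X]mul1r -mulrDl natr1 natrD natrM.
  by rewrite (le_trans (ler_wpM2l _ nh)) // lerDr.
have Xs : supported (strict_chain X m) (<< s >> : C).
  by apply: supportedU; apply: strict_sub xs => y; exact: linkX.
rewrite bdl_cons 2!linearB /= bdl_cone (hX _ _ Xs).
(* For a cone over the empty list the boundary of the base is zero, and the
   truncated predecessor is harmless. *)
rewrite (hcone _ _ m.-1) //; last first.
  case: m xs {mk sh Xc Xs} => [|m] xs; last exact: supported_strict_bdl.
  by case/and3P: xs => _ _; case: (s) => // _; rewrite bdlU; exact: supported0.
have -> : fglift (hb x) (bdl << s >>) = << s >> - bdl c.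
  by apply/eqP; rewrite eq_sym subr_eq addrC eh.
rewrite !linearB /= coneU.
have -> : bdl (fglift h0 c) = c - fglift h0 (bdl c).
  by rewrite -{2}(contraction_lift h0P mk Xc) addrK.
by apply/eqP/freeg_eqP => t; rewrite !(coeffD, coeffN); ring.
Qed.

End OrderedLists.

(** * Comparison with the simplicial chains of the order complex *)

Section FromLists.
Context (R : realType) (d : Order.disp_t) (P : porderType d).
Local Notation C := {freeg (seq P) / R}.
Local Notation X := (order_complex P).
Local Notation RC k := (reduced_obj R X k).

Lemma list_bdE (s : seq P) : list_bd R s =
  \sum_(i < size s) (-1) ^+ i *: << take i s ++ drop i.+1 s >>.
Proof.
elim: s => [|x s IH] /=; first by rewrite big_ord0.
rewrite big_ord_recl /= drop0 expr0 scale1r IH linear_sum -sumrN; congr (_ + _).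
by apply: eq_bigr => i _; rewrite linearZ /= coneU exprS mulN1r scaleNr.
Qed.

Definition chain_list q (x : chain P q) : seq P := val (val x).

Lemma strict_chain_list q (x : chain P q) :
  strict_chain predT q.+1 (chain_list x).
Proof.
by rewrite /strict_chain all_predT size_tuple eqxx /= andbT; exact: (valP x).
Qed.

Lemma chain_list_face q (x : chain P q.+1) (i : 'I_q.+2) :
  chain_list (face_chain i x) = take i (chain_list x) ++ drop i.+1 (chain_list x).
Proof.
have szx : size (chain_list x) = q.+2 by exact: size_tuple.
have li := ltn_ord i.
have x0 : P := tnth (val x) ord0.
apply: (@eq_from_nth _ x0).
  by rewrite size_tuple size_cat size_drop size_takel szx; lia.
move=> j; rewrite size_tuple => lj.
have -> : nth x0 (chain_list (face_chain i x)) j =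
    nth x0 (chain_list x) (bump i j).
  rewrite -(tnth_nth x0 (val (face_chain i x)) (Ordinal lj)) tnth_mktuple.
  by rewrite (tnth_nth x0).
rewrite nth_cat size_takel ?szx; last lia.
rewrite /bump; case: (ltnP j i) => ij; first by rewrite add0n nth_take.
by rewrite nth_drop; congr nth; lia.
Qed.

(** The scalars in degree [-1] are the multiples of the empty list. *)
Definition empty_simplex (r : R^o) : C := r *: << [::] >>.

Lemma empty_simplex_linear : linear empty_simplex.
Proof. by move=> a u v; rewrite /empty_simplex scalerDl scalerA. Qed.

HB.instance Definition _ :=
  GRing.isLinear.Build R R^o C *:%R empty_simplex empty_simplex_linear.

Definition to_list k : {linear RC k -> C} :=
  if k is q.+1 then fglift (fun x : chain P q => << chain_list x >>)
  else empty_simplex.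

Definition list_chain q (s : seq P) : option (chain P q) :=
  obind (fun t : q.+1.-tuple P => insub t) (insub s).

Lemma chain_listK q : pcancel (@chain_list q) (@list_chain q).
Proof. by move=> x; rewrite /list_chain valK /= valK. Qed.

Definition of_list k : {linear C -> RC k} :=
  if k is q.+1 then
    fglift (fun s : seq P =>
      oapp (fun x : chain P q => << x >>) 0 (list_chain q s))
  else fglift (fun s : seq P => (nilp s)%:R : R^o).

Lemma to_list0 (r : RC 0) : to_list 0 r = r *: << [::] >>.
Proof. by []. Qed.

Lemma bdl_to_list0 (r : RC 0) : bdl (to_list 0 r) = 0.
Proof. by rewrite to_list0 linearZ /= bdlU scaler0. Qed.

Lemma to_listS q (x : chain P q) : to_list q.+1 << x >> = << chain_list x >>.
Proof. exact: fgliftU1. Qed.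

Lemma to_listK k (c : RC k) : of_list k (to_list k c) = c.
Proof.
case: k c => [|q] c; first by rewrite /= linearZ /= fgliftU1 [_ *: _]mulr1.
apply: (@eq_on_basis _ _ _ (of_list q.+1 \o to_list q.+1) idfun) => x /=.
by rewrite !fgliftU1 chain_listK.
Qed.

Lemma to_list_bd k (c : RC k.+1) :
  to_list k (reduced_bd R X k c) = bdl (to_list k.+1 c).
Proof.
case: k c => [|q] c.
  apply: (@eq_on_basis _ _ _ (to_list 0 \o reduced_bd R X 0) (bdl \o to_list 1)).
  move=> x /=; rewrite !fgliftU1 bdlU.
  case: x => -[[|y [|z s]] //= i] j.
  by rewrite /chain_list /= linear0 subr0 /empty_simplex scale1r.
apply: (@eq_on_basis _ _ _ (to_list q.+1 \o reduced_bd R X q.+1)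
  (bdl \o to_list q.+2)) => x /=.
rewrite !fgliftU1 bdlU list_bdE linear_sum size_tuple.
by apply: eq_bigr => i _; rewrite linearZ /= fgliftU1 chain_list_face.
Qed.

Lemma supported_to_list k (c : RC k) :
  supported (strict_chain predT k) (to_list k c).
Proof.
case: k c => [|q] c; first by apply: supportedZ; exact: supportedU.
apply: (@supported_lift _ _ _ xpredT) => // x _.
by apply: supportedU; exact: strict_chain_list.
Qed.

(** On strict lists [of_list] inverts [to_list], which commutes with
boundaries. *)
Lemma bd_of_list k (c : C) : supported (strict_chain predT k.+1) c ->
  reduced_bd R X k (of_list k.+1 c) = of_list k (bdl c).
Proof.
move=> sc; apply: (@eq_on_support _ _ _ _ (reduced_bd R X k \o of_list k.+1)
  (of_list k \o bdl) _ _ sc) => s /and3P[ss _ szs].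
pose x : chain P k := Sub (Tuple szs) ss.
rewrite (_ : << s >> = to_list k.+1 << x >>); last by rewrite to_listS.
transitivity (reduced_bd R X k << x >>).
  by congr (reduced_bd R X k _); exact: to_listK.
rewrite -[LHS]to_listK; congr (of_list k _); exact: to_list_bd.
Qed.

Lemma norm_to_list k (c : RC k) : l1norm (to_list k c) <= reduced_norm c.
Proof.
case: k c => [|q] c; first by rewrite l1normZ l1normU mulr1.
rewrite -[leRHS]mul1r; apply: (@l1norm_lift _ _ _ xpredT) => // x _.
by rewrite l1normU.
Qed.

Lemma norm_of_list k (c : C) : reduced_norm (of_list k c) <= l1norm c.
Proof.
case: k => [|q].
  rewrite /= fgliftE /l1norm (le_trans (ler_norm_sum _ _ _)) // ler_sum // => s _.
  rewrite [_ *: _]/( _ * _) normrM.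
  by case: nilp; rewrite ?normr1 ?mulr1 ?normr0 ?mulr0.
rewrite -[leRHS]mul1r; apply: (@l1norm_lift _ _ _ xpredT) => // s _.
by case: list_chain => [x|] /=; rewrite ?l1normU ?l1norm0.
Qed.

End FromLists.

Arguments to_list {R d P} k.
Arguments of_list {R d P} k.

(** * Consequences of a bounded contracting homotopy *)

Section ContractedComplexes.
Context (R : realType) (C : normedComplex R) (n : nat) (K : R).
Variable H : forall k, {linear C k -> C k.+1}.
Hypotheses
  (H0 : forall c, (0 < n)%N -> bd C 0 (H 0 c) = c)
  (HS : forall k c, (k.+1 < n)%N -> bd C k.+1 (H k.+1 c) + H k (bd C k c) = c)
  (HK : forall k c, (k < n)%N -> cnorm (H k c) <= K * cnorm c).

(** On a cycle the second term of the homotopy identity vanishes; at the bottom of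
the complex the identity has only the first term, and everything is a cycle. *)
Lemma cycle_bd_contraction k (c : C k) :
  (k < n)%N -> is_cycle c -> bd C k (H k c) = c.
Proof.
case: k c => [|k] c kn zc; first exact: H0.
by rewrite -{2}(HS c kn) [bd C k c]zc linear0 addr0.
Qed.

Lemma homology_contracted k : (k < n)%N -> homology_vanishes C k.
Proof. by move=> kn c zc; exists (H k c); exact: cycle_bd_contraction. Qed.

Lemma UBC_contracted k : (k < n)%N -> UBC C k K.
Proof.
move=> kn s [b bs]; exists (H k s); split; last exact: HK.
apply: cycle_bd_contraction => //.
by case: k b s bs {kn} => //= k b s <-; exact: bdK.
Qed.

(** A cocycle [f] kills the first term of [f = f (bd H + H bd)], so [f] is the
coboundary of the bounded functional [f H].  Linearity of [H] takes the place of
a Hahn-Banach extension. *)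
Lemma bounded_cohomology_contracted k :
  (k < n)%N -> bounded_cohomology_vanishes C k.
Proof.
case: k => [|k] kn f [M fM] zf /=.
  by move=> c; rewrite -(H0 c kn); exact: zf.
exists (f \o H k).
  exists (`|M| * K) => c; apply: le_trans (fM _) _.
  apply: le_trans (ler_wpM2r (cnorm_ge0 _) (ler_norm M)) _.
  by rewrite -mulrA ler_wpM2l // HK // ltnW.
by move=> c; rewrite -{1}(HS c kn) linearD zf add0r.
Qed.

End ContractedComplexes.

Lemma bounded_cohomology_zero (R : realType) (C : normedComplex R) k :
  (forall c : C k, c = 0) -> bounded_cohomology_vanishes C k.
Proof.
case: k => [|k] C0 f _ _ /=; first by move=> c; rewrite (C0 c) linear0.
exists (\0 : {scalar C k}).
  by exists 0 => c; rewrite normr0 mul0r.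
by move=> c; rewrite (C0 c) !linear0.
Qed.

Section OrderComplexConsequences.
Context (R : realType) (d : Order.disp_t) (P : porderType d).
Local Notation X := (order_complex P).
Variables (n K : nat).
Hypothesis cP : contractible R (predT : pred P) n K.

Lemma reduced_contraction :
  exists H : forall k, {linear reduced_chains R X k -> reduced_chains R X k.+1},
  [/\ forall c, (0 < n)%N -> bd (reduced_chains R X) 0 (H 0 c) = c,
      forall k c, (k.+1 < n)%N -> bd (reduced_chains R X) k.+1 (H k.+1 c) +
        H k (bd (reduced_chains R X) k c) = c &
      forall k (c : reduced_chains R X k), (k < n)%N ->
        cnorm (H k c) <= K%:R * cnorm c].
Proof.
have [h hP] := cP.
have sup k (c : reduced_obj R X k) : (k < n)%N ->
    supported (strict_chain predT k.+1) (fglift h (to_list _ c)).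
  move=> kn; apply: supported_lift (@supported_to_list R d P _ c) => s.
  by case/(hP _ _ kn).
exists (fun k => (of_list k.+1 \o fglift h) \o to_list k); split.
- move=> c n0; transitivity (of_list 0 (bdl (fglift h (to_list 0 c)))).
    exact: bd_of_list (sup 0%N c n0).
  rewrite -[RHS]to_listK; congr (of_list 0 _).
  have := contraction_lift hP n0 (@supported_to_list R d P 0 c).
  rewrite (@bdl_to_list0 R d P c) linear0 addr0; exact.
- move=> k c kn.
  transitivity (of_list k.+1 (bdl (fglift h (to_list _ c)) +
      fglift h (bdl (to_list _ c)))).
    rewrite linearD; congr (_ + _); first exact: bd_of_list (sup _ c kn).
    by rewrite -to_list_bd.
  rewrite -[RHS]to_listK; congr (of_list k.+1 _).
  exact: contraction_lift hP kn (@supported_to_list R d P _ c).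
- move=> k c kn; apply: le_trans (norm_of_list _ _) _.
  apply: le_trans (ler_wpM2l (ler0n _ _) (norm_to_list c)).
  apply: l1norm_lift (@supported_to_list R d P _ c) => //.
  by move=> s /(hP _ _ kn) [].
Qed.

(** The homotopy fills the scalar [1] in degree [-1], so there is a vertex as
soon as [n > 0]. *)
Lemma uniformly_acyclic_contractible : uniformly_acyclic R X (n%:Z - 2).
Proof.
have [H [H0 HS HK]] := reduced_contraction.
move=> n1; split.
- have n0 : (0 < n)%N by lia.
  have H1 := H0 1 n0.
  have: H 0%N (1 : R^o) != 0.
    by apply/eqP => E; move: H1; rewrite E linear0 => /esym/eqP; rewrite oner_eq0.
  rewrite -dom_eq0; case: (dom _) => // x _ _; exact: (inhabits x).
- move=> q qn k kq; apply: homology_contracted H0 HS _ _; lia.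
- by move=> q qn; exists K%:R; apply: (UBC_contracted H0 HS HK (k := q.+1)); lia.
Qed.

Lemma UBC_contractible q : q%:Z <= n%:Z - 2 -> UBC (chains R X) q K%:R.
Proof.
have [H [H0 HS HK]] := reduced_contraction => qn.
have qn' : (q.+1 < n)%N by lia.
exact: (UBC_contracted H0 HS HK qn').
Qed.

Lemma bounded_cohomology_contractible (k : nat) :
  (k < n)%N -> bounded_cohomology_vanishes (reduced_chains R X) k.
Proof.
have [H [H0 HS HK]] := reduced_contraction.
by move=> kn; exact: (bounded_cohomology_contracted H0 HS HK).
Qed.

End OrderComplexConsequences.

(** * Isotropic subspaces and the polar of a vector *)

Section SymplecticForm.
Context (F : fieldType) (n : nat).
Local Notation V := 'rV[F]_(n + n).
Implicit Types (u v e : V) (U W : {vspace V}).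

Lemma omega_linear u : linear (omega u : V -> F^o).
Proof.
move=> a v w; rewrite /omega scaler_sumr -big_split /=; apply: eq_bigr => i _.
by rewrite !mxE /GRing.scale /=; ring.
Qed.

HB.instance Definition _ u :=
  GRing.isLinear.Build F V F^o *:%R (omega u) (omega_linear u).

Lemma omegaC u v : omega u v = - omega v u.
Proof. by rewrite /omega -sumrN; apply: eq_bigr => i _; ring. Qed.

Lemma omegaDl u v w : omega (u + v) w = omega u w + omega v w.
Proof. by rewrite !(omegaC _ w) linearD opprD. Qed.

Lemma omegaZl a u w : omega (a *: u) w = a * omega u w.
Proof. by rewrite !(omegaC _ w) linearZ /= mulrN. Qed.

Lemma omega_alt u : omega u u = 0.
Proof. by rewrite /omega big1 // => i _; rewrite mulrC subrr. Qed.

Definition polar e : {vspace V} := lker (linfun (omega e : V -> F^o)).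

Lemma mem_polar e v : (v \in polar e) = (omega e v == 0).
Proof. by rewrite memv_ker lfunE. Qed.

(** The polar is the kernel of a linear form. *)
Lemma dim_cap_polar U e : (\dim U <= (\dim (U :&: polar e)).+1)%N.
Proof.
rewrite -(limg_ker_dim (linfun (omega e : V -> F^o)) U) -[leqRHS]addn1 leq_add2l.
by rewrite (leq_trans (dimvS (subvf _))) // dimvf.
Qed.

Lemma isotropic_sub U W : (U <= W)%VS -> isotropic W -> isotropic U.
Proof. by move=> UW iW u v uU vU; apply: iW; apply: (subvP UW). Qed.

Lemma isotropic_add_line U e :
  isotropic U -> (U <= polar e)%VS -> isotropic (U + <[e]>).
Proof.
move=> iU /subvP Ue x y /memv_addP[u uU [_ /vlineP[a ->] ->]].
move=> /memv_addP[v vU [_ /vlineP[b ->] ->]].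
move: (Ue _ uU) (Ue _ vU); rewrite !mem_polar => /eqP ou /eqP ov.
rewrite omegaDl omegaZl !linearD !linearZ /= iU // ov omega_alt (omegaC u) ou oppr0.
by rewrite !(scaler0, addr0, mulr0).
Qed.

(** The orthogonal of [U] is cut out by [\dim U] equations, so its dimension is at
least [2 n - \dim U > \dim U]. *)
Lemma exists_polar_notin U : (\dim U < n)%N ->
  exists2 e, (U <= polar e)%VS & e \notin U.
Proof.
move=> dU.
pose f : V -> 'rV[F]_(\dim U) := fun v => \row_i omega (vbasis U)`_i v.
have f_lin : linear f.
  by move=> a v w; apply/rowP => i; rewrite !mxE linearP.
pose fL := HB.pack_for {linear V -> 'rV[F]_(\dim U)} f
  (GRing.isLinear.Build F V 'rV[F]_(\dim U) *:%R f f_lin).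
have /subvPn[e ek eU] : ~~ (lker (linfun fL) <= U)%VS.
  apply/negP => /dimvS.
  have := limg_ker_dim (linfun fL) fullv; rewrite capfv dimvf /dim /= mul1n.
  have := dimvS (subvf (linfun fL @: fullv)%VS); rewrite dimvf /dim /= mul1n.
  move=> limU E kerU; have := leq_add kerU limU.
  by rewrite E leqNgt (leq_add dU (ltnW dU)).
exists e => //; apply/subvP => u uU; rewrite mem_polar omegaC oppr_eq0.
rewrite (coord_vbasis uU); apply/eqP.
elim/big_rec: _ => [|i x _ IH]; first by rewrite omegaC linear0 oppr0.
rewrite omegaDl omegaZl IH addr0.
move: ek; rewrite memv_ker lfunE /= => /eqP/rowP/(_ i); rewrite !mxE => ->.
by rewrite mulr0.
Qed.

(** With [M] a matrix of a basis of [U] and [J] the Gram matrix of the form,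
[M J M^T = 0]; as [J] is invertible, both [M J] and [M^T] have rank [\dim U], so
twice this number is at most [2 n]. *)
Lemma dim_isotropic U : isotropic U -> (\dim U <= n)%N.
Proof.
move=> iU.
pose J : 'M[F]_(n + n) := block_mx 0 1%:M (- 1%:M) 0.
have JE u v : (u *m J *m v^T) 0 0 = omega u v.
  rewrite -{1}[u]hsubmxK mul_row_block !mulmx0 mulmx1 mulmxN mulmx1 add0r addr0.
  rewrite -{1}[v]hsubmxK tr_row_mx mul_row_col !mxE -big_split /=.
  by apply: eq_bigr => i _; rewrite !mxE; ring.
pose M : 'M[F]_(\dim U, n + n) := \matrix_i (vbasis U)`_i.
have Mu w : w *m M = \sum_i w 0 i *: (vbasis U)`_i.
  by rewrite mulmx_sum_row; apply: eq_bigr => i _; rewrite rowK.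
have M_free : row_free M.
  apply/inj_row_free => w; rewrite Mu => w0; apply/rowP => i; rewrite mxE.
  have := basis_free (vbasisP U); move/freeP/(_ (w 0)); exact.
have MJM : (M *m J) *m M^T = 0.
  apply/matrixP => i j; have o0 : omega (row i M) (row j M) = 0.
    by rewrite !rowK iU // vbasis_mem // mem_nth // size_tuple.
  rewrite [RHS]mxE -o0 -JE !mxE; apply: eq_bigr => k _; rewrite !mxE; congr (_ * _).
  by apply: eq_bigr => l _; rewrite !mxE.
have J_unit : J \in unitmx.
  have JJ : J *m (- J) = 1%:M.
    rewrite mulmxN /J mulmx_block.
    rewrite !(mul0mx, mulmx0, mulmx1, mul1mx, mulmxN, add0r, addr0).
    by rewrite opp_block_mx opprK oppr0 -scalar_mx_block.
  by case/mulmx1_unit: JJ.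
have := mulmx0_rank_max MJM; rewrite mxrank_tr mxrankMfree ?row_free_unit //.
rewrite (eqP M_free).
by case: (leqP (\dim U) n) => // nU; rewrite leqNgt (leq_add nU (ltnW nU)).
Qed.

End SymplecticForm.

(** * The symplectic Tits building *)

Section TitsBuilding.
Context (R : realType) (F : fieldType) (n : nat).
Local Notation P := (isotropic_subspace F n).
Implicit Types (U : {vspace 'rV[F]_(n + n)}) (V W : P).

Lemma le_isotropicE V W : (V <= W)%O = (val V <= val W)%VS.
Proof. by []. Qed.

Lemma isotropic_val V : isotropic (val V).
Proof. by have /andP[_ /asboolP] := valP V. Qed.

Lemma dim_val_gt0 V : (0 < \dim (val V))%N.
Proof. by have /andP[V0 _] := valP V; rewrite lt0n dimv_eq0. Qed.

Lemma ltn_dimv (K : fieldType) (E : vectType K) (A B : {vspace E}) :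
  (A <= B)%VS -> ~~ (B <= A)%VS -> (\dim A < \dim B)%N.
Proof. by move=> /dimv_leqif_sup le; rewrite (ltn_leqif le). Qed.

Lemma lt_isotropicE V W :
  (V < W)%O = (val V <= val W)%VS && (\dim (val V) < \dim (val W))%N.
Proof.
rewrite lt_leAnge !le_isotropicE; have [VW|//] := boolP (val V <= val W)%VS.
by rewrite (ltn_leqif (dimv_leqif_sup VW)).
Qed.

Lemma insubd_isotropic V0 U :
  (0 < \dim U)%N -> isotropic U -> val (insubd V0 U : P) = U.
Proof.
move=> dU iU; apply: insubdK; rewrite unfold_in -dimv_eq0 -lt0n dU /=.
exact/asboolP.
Qed.

Definition above U : pred P :=
  fun V => (U <= val V)%VS && (\dim U < \dim (val V))%N.

(** This is what closes the induction: links stay within the family. *)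
Lemma above_link U V : above U V ->
  (fun W => above U W && (V < W)%O) = above (val V).
Proof.
case/andP=> UV dUV; apply/funext => W; rewrite /above lt_isotropicE andb_idl //.
by case/andP => VW dVW; rewrite (subv_trans UV) // (ltn_trans dUV).
Qed.

Lemma above0 : above 0 = predT.
Proof. by apply/funext => V; rewrite /above sub0v dimv0 dim_val_gt0. Qed.

(** The recursion of [attach_cones], with the bound [2 k + 1] of
[conical_contraction] for the contractible part. *)
Fixpoint filling_constant k : nat :=
  if k is k'.+1 then k.*2.+1 + k.*2.+2 * filling_constant k' else 0.

Lemma contractible_above k U : isotropic U -> (\dim U + k <= n)%N ->
  contractible R (above U) k (filling_constant k).
Proof.
elim: k U => [|k IH] U iU dUn; first by exists (fun=> 0).
have dUlt : (\dim U < n)%N by apply: leq_trans dUn; rewrite addnS ltnS leq_addr.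
have [e Ue eU] := exists_polar_notin dUlt.
have isoUe := isotropic_add_line iU Ue.
have dUe : (\dim U < \dim (U + <[e]>))%N.
  apply: ltn_dimv (addvSl _ _) _; apply: contra eU => /subvP; apply.
  exact: (subvP (addvSr _ _)) (memv_line e).
have e_polar : (<[e]> <= polar e)%VS by rewrite -memvE mem_polar omega_alt.
have dUe0 : (U + <[e]>)%VS != 0%VS.
  by rewrite -dimv_eq0 -lt0n (leq_ltn_trans _ dUe).
have vP : (U + <[e]> != 0)%VS && `[< isotropic (U + <[e]>) >].
  by rewrite dUe0; apply/asboolP.
pose v : P := exist _ (U + <[e]>)%VS vP.
pose trace V := (val V :&: polar e)%VS.
(* As [trace V] contains [U] for [V] above [U], this says that they are equal. *)
pose B V := (\dim (trace V) <= \dim U)%N.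
(* The default [v] is taken only at bad subspaces. *)
pose f V : P := insubd v (trace V).
pose g V : P := insubd v (trace V + <[e]>)%VS.
have iso_trace V : isotropic (trace V).
  exact: isotropic_sub (capvSl _ _) (@isotropic_val V).
have fE V : ~~ B V -> val (f V) = trace V.
  rewrite -ltnNge => dV; rewrite insubd_isotropic //.
  exact: leq_ltn_trans dV.
have gE V : ~~ B V -> val (g V) = (trace V + <[e]>)%VS.
  rewrite -ltnNge => dV; rewrite insubd_isotropic //.
    by apply: leq_trans (dimvS (addvSl _ _)); exact: leq_ltn_trans dV.
  by apply: isotropic_add_line => //; exact: capvSr.
have dimB V : B V -> (\dim (val V) <= (\dim U).+1)%N.
  by move=> BV; apply: leq_trans (dim_cap_polar _ e) _; rewrite ltnS.
have in_polar V : (val V <= polar e)%VS -> trace V = val V by move=> /capv_idPl.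
have X_polar V : (U <= val V)%VS -> (\dim U < \dim (val V))%N ->
    (val V <= polar e)%VS -> above U V && ~~ B V.
  by move=> UV dV /in_polar tV; rewrite /above UV dV /B tV -ltnNge.
have Utrace V : above U V -> (U <= trace V)%VS.
  by case/andP => UV _; rewrite subv_cap UV.
rewrite /=; apply: (@attach_cones R _ P (above U) B k).
- move=> x y /andP[_ dx] _ By; apply/negP; rewrite lt_isotropicE => /andP[_ dxy].
  by have := dimB y By; rewrite leqNgt (leq_ltn_trans dx dxy).
- apply: (conical_contraction R (f := f) (g := g) (v := v)).
  + by apply: X_polar; rewrite ?addvSl // subv_add Ue.
  + move=> V /andP[aV nB]; apply: X_polar; rewrite fE //; last exact: capvSr.
      exact: Utrace.
    by rewrite ltnNge.
  + move=> V /andP[aV nB]; apply: X_polar; rewrite gE //.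
    * exact: subv_trans (Utrace V aV) (addvSl _ _).
    * by apply: leq_trans (dimvS (addvSl _ _)); rewrite ltnNge.
    * by rewrite subv_add capvSr.
  + by move=> V /andP[_ nB]; rewrite le_isotropicE fE // capvSl.
  + by move=> V /andP[_ nB]; rewrite le_isotropicE fE // gE // addvSl.
  + move=> V /andP[aV nB]; rewrite le_isotropicE gE //.
    by apply: addvS => //; exact: Utrace.
  + move=> V W /andP[_ nBV] /andP[_ nBW]; rewrite !le_isotropicE !fE //.
    by move=> VW; apply: capvS.
  + move=> V W /andP[_ nBV] /andP[_ nBW]; rewrite !le_isotropicE !gE //.
    by move=> VW; apply: addvS => //; apply: capvS.
- move=> V aV BV; rewrite above_link //; apply: IH; first exact: isotropic_val.
  rewrite (leq_trans _ dUn) // addnS -addSn leq_add2r.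
  exact: dimB.
Qed.

Lemma path_dim V (s : seq P) : path <%O V s ->
  (\dim (val V) + size s <= \dim (val (last V s)))%N.
Proof.
elim: s V => [|W s IH] V /=; first by rewrite addn0.
rewrite lt_isotropicE => /andP[/andP[_ dVW] /IH]; apply: leq_trans.
by rewrite addnS -addSn leq_add2r.
Qed.

Lemma chain_dim q (x : chain P q) : (q < n)%N.
Proof.
case: x => -[[|V s] szs pVs] //; have := path_dim pVs.
move: (szs) => /eqP[->] dq.
have := dim_isotropic (@isotropic_val (last V s)).
apply: leq_trans; apply: leq_trans dq.
by rewrite -add1n leq_add2r dim_val_gt0.
Qed.

Lemma chains_eq0 q (c : {freeg (chain P q) / R}) : (n <= q)%N -> c = 0.
Proof.
move=> nq; apply/eqP; rewrite -dom_eq0; case: (dom c) => // x s.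
by have := chain_dim x; rewrite ltnNge nq.
Qed.

End TitsBuilding.

Theorem theorem8p4 (R : realType) :
  exists KT : nat -> R, forall (F : fieldType) (n : nat),
    [/\ uniformly_acyclic R (symplectic_Tits_building F n) (n%:Z - 2),
        forall q : nat, q%:Z <= n%:Z - 2 ->
          UBC (chains R (symplectic_Tits_building F n)) q (KT n) &
        forall q : int, q <> n%:Z - 1 ->
          reduced_bounded_cohomology_vanishes R
            (symplectic_Tits_building F n) q].
Proof.
exists (fun n => (filling_constant n)%:R) => F n.
have cT : contractible R (predT : pred (isotropic_subspace F n)) n
    (filling_constant n).
  rewrite -above0; apply: contractible_above; last by rewrite dimv0.
  by move=> u v; rewrite !memv0 => /eqP-> /eqP->; rewrite omega_alt.
split.
- exact: uniformly_acyclic_contractible cT.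
- by move=> q qn; exact: (UBC_contractible cT qn).
- move=> q qn k kq; have [kn|nk] := ltnP k n.
    exact: (bounded_cohomology_contractible cT).
  apply: bounded_cohomology_zero.
  case: k kq nk => [|k] kq nk c; first by lia.
  by apply: chains_eq0; lia.
Qed.
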